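(* For every odd-cycle graph $G$ with $n$ vertices, $\rho(G)\le \rho(H_n)$, and equality holds if and only if $G\cong H_n$.
   Context: All graphs are finite and simple. $\rho(G)$ denotes the spectral radius (index) of $G$, i.e. the largest eigenvalue of its adjacency matrix. A graph is called an odd-cycle graph if each of its cycles has odd length (odd number of edges). $H_n$ is the graph on $n$ vertices obtained from the star $K_{1,n-1}$ by adding $\lfloor \frac{n-1}{2}\rfloor$ independent (pairwise vertex-disjoint) edges between pairs of pendant vertices of the star. *)

(* Defs.v *)
From mathcomp Require Import all_boot all_order all_algebra.
From mathcomp Require Import all_classical all_reals.

Set Implicit Arguments.
Unset Strict Implicit.
Unset Printing Implicit Defensive.

Import Order.TTheory GRing.Theory Num.Theory.

Local Open Scope ring_scope.

Record sgraph := SGraph {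
  svertex :> finType;
  sedge : rel svertex;
  sedge_sym : symmetric sedge;
  sedge_irrefl : irreflexive sedge }.

Definition sgraph_iso (G H : sgraph) : Prop :=
  exists f : G -> H,
    bijective f /\ forall x y : G, sedge (f x) (f y) = sedge x y.

(* [ucycle] also accepts the sequences [::] and [:: x; y] (an edge traversed
   back and forth), hence the bound on the size. A cycle given by the list of
   its distinct vertices has as many edges as vertices. *)
Definition odd_cycle_graph (G : sgraph) : Prop :=
  forall c : seq G, (2 < size c)%N -> ucycle (@sedge G) c -> odd (size c).

Definition adjacency (R : realType) (G : sgraph) : 'M[R]_#|G| :=
  \matrix_(i, j) (sedge (enum_val i) (enum_val j))%:R.

Definition is_largest_eigenvalue (R : realType) (n : nat) (A : 'M[R]_n)
    (a : R) : Prop :=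
  eigenvalue A a /\ forall b : R, eigenvalue A b -> b <= a.

(* An adjacency matrix is real symmetric, so for a nonempty graph the largest
   eigenvalue exists (and is unique); the default value 0 is only reached by
   the graph without vertices. *)
Definition spectral_radius (R : realType) (G : sgraph) : R :=
  xget 0 [set a | is_largest_eigenvalue (adjacency R G) a]%classic.

(* The centre of the star is 0; the added edges are {1, 2}, {3, 4}, ...,
   {2k - 1, 2k} with 2k <= n - 1, that is, (n - 1) / 2 of them. *)
Definition H_arc (i j : nat) : bool :=
  ((i == 0) && (0 < j) || odd i && (j == i.+1))%N.

Definition H_edge (n : nat) : rel 'I_n := fun i j => H_arc i j || H_arc j i.

Lemma H_edge_sym n : symmetric (@H_edge n).
Proof. by move=> i j; rewrite /H_edge orbC. Qed.

Lemma H_edge_irrefl n : irreflexive (@H_edge n).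
Proof.
move=> i; rewrite /H_edge orbb /H_arc.
by rewrite (ltn_eqF (ltnSn i)) andbF orbF lt0n; case: eqP.
Qed.

Definition H_graph (n : nat) : sgraph :=
  SGraph (@H_edge_sym n) (@H_edge_irrefl n).

(* Main.v *)
Require Import Defs.
From mathcomp Require Import all_boot all_order all_algebra.
From mathcomp Require Import all_classical all_reals.
From mathcomp Require Import zify ring lra.

Set Implicit Arguments.
Unset Strict Implicit.
Unset Printing Implicit Defensive.

Import Order.TTheory GRing.Theory Num.Theory.

(** Let [f >= 0] be an eigenvector of the adjacency matrix of [G] for its
    spectral radius, and let [u] be a vertex where [f] is maximal. Arrange the
    vertices in levels by their distance to [u] (in the components that miss
    [u], to an arbitrary root of the component). Every edge joins two consecutive
    levels or stays inside a level. Two distinct vertices of one level that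
    have a common neighbour not below them would close an even cycle: climb down
    from both to the first common ancestor ([level_bridge]). Hence every vertex
    has at most one neighbour one level down, and at most one in its own level
    ([lower_neighbour_uniq], [same_level_neighbour_uniq]), so the edges inside
    the levels form a matching [m], which avoids [u].

    The quadratic form of the adjacency matrix, here called [energy], sums
    [f v * f w] over the ordered adjacent pairs. Replacing the edge from [v <> u]
    down to its lower neighbour [w] by the edge from [v] to [u] does not decrease it,
    since [f w <= f u]. The result is the energy of the cone over the matching
    [m] with apex [u] ([energy_le_cone]), and such a cone is a spanning
    subgraph of [H_n] ([cone_embedding]). By the Rayleigh principle
    ([spectral_radiusP]),
      [rho G * normsq f = energy G f <= energy cone f <= energy H_n f
         <= rho H_n * normsq f].

    If the radii agree, all these inequalities are equalities. Then [f] is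
    also an eigenvector of [H_n], so it is positive, so the cone is all of
    [H_n], and every vertex [v <> u] has a lower neighbour [w] with
    [f w = f u]. If [w] were not [u], comparing the eigenvalue equations of
    the cone at [w] and at [u] would make every vertex other than [u] and [w] a partner
    of [w] in [m] ([cone_eigen_center]); but [v] lies one level above
    [w], whereas partners share a level. So every vertex other than [u] is
    adjacent to [u], and [G] is the cone. *)

(** * Levels in an odd-cycle graph *)

(** What is needed of the distance to a set of roots, one of them [u], that
    meets every component exactly once. *)
Record leveling (G : sgraph) (u : G) (l : G -> nat) : Prop := Leveling {
  level_root : l u = 0%N;
  level_step : forall v w : G, sedge v w -> (l v <= (l w).+1)%N;
  level_parent : forall v : G, (0 < l v)%N ->
    exists2 w : G, sedge v w & l v = (l w).+1;
  level0_inj : forall v w : G, l v = 0%N -> l w = 0%N ->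
    connect (@sedge G) v w -> v = w }.

Lemma sedge_connect_sym (G : sgraph) : connect_sym (@sedge G).
Proof. exact: sym_connect_sym (@sedge_sym G). Qed.

(** The level of [v] is the length of a shortest path to [v] from the root
    [r v] of its component, [u] being taken as the root of its own. *)
Lemma exists_leveling (G : sgraph) (u : G) : exists l : G -> nat, leveling u l.
Proof.
set e := @sedge G; have ce := @sedge_connect_sym G.
pose r v := if connect e u v then u else fingraph.root e v.
have r_conn v : connect e (r v) v.
  rewrite /r; case: ifP => // _; rewrite ce; exact: connect_root.
have r_eq v w : connect e v w -> r v = r w.
  move=> cvw; rewrite /r (same_connect_r ce cvw).
  by case: ifP => // _; apply/eqP; rewrite root_connect.
pose P v k := [exists t : k.-tuple (svertex G), path e (r v) t && (last (r v) t == v)].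
have PP v k : reflect (exists p, [/\ path e (r v) p, last (r v) p = v & size p = k]) (P v k).
  apply: (iffP existsP) => [[t /andP[pt /eqP lt]]|[p [pp lp sp]]].
    by exists t; rewrite size_tuple.
  by move/eqP: sp => sp; exists (Tuple sp); rewrite /= pp lp eqxx.
have exP v : exists k, P v k.
  have /connectP[p pp lp] := r_conn v.
  by exists (size p); apply/PP; exists p.
pose l v := ex_minn (exP v).
have l_min v p : path e (r v) p -> last (r v) p = v -> (l v <= size p)%N.
  rewrite /l; case: ex_minnP => m _ mP pp lp.
  by apply: mP; apply/PP; exists p.
have l_ex v : exists p, [/\ path e (r v) p, last (r v) p = v & size p = l v].
  by rewrite /l; case: ex_minnP => m /PP[p [pp lp <-]]; exists p.
have step v w : e v w -> (l v <= (l w).+1)%N.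
  move=> evw; have [p [pp lp <-]] := l_ex w.
  rewrite -(size_rcons p v); apply: l_min.
    by rewrite rcons_path (r_eq _ _ (connect1 evw)) pp lp /e sedge_sym.
  by rewrite last_rcons.
have l0 v : l v = 0%N -> v = r v.
  by move=> lv; have [p [_ lp]] := l_ex v; rewrite lv => /size0nil p0; rewrite p0 in lp.
exists l; split => //.
- have ru : r u = u by rewrite /r connect0.
  by apply/eqP; rewrite -leqn0; apply: (l_min u [::]).
- move=> v lv; have [p [pp lp sp]] := l_ex v.
  case: (lastP p) sp pp lp => [/esym h|q x sp]; first by rewrite h in lv.
  rewrite rcons_path last_rcons => /andP[pq eqx] xv; subst x.
  set w := last (r v) q in eqx.
  have evw : e v w by rewrite /e sedge_sym.
  exists w => //; apply/eqP; rewrite eqn_leq step //=.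
  rewrite -sp size_rcons ltnS; apply: l_min; rewrite -(r_eq _ _ (connect1 evw)) //.
- by move=> v w /l0 ev /l0 ew cvw; rewrite ev ew; apply: r_eq.
Qed.

Section LevelStructure.
Variables (G : sgraph) (u : G) (l : G -> nat).
Hypothesis lG : leveling u l.
Local Notation e := (@sedge G).

(** Follow parents from [a] and from [b] until they meet; the bridge goes down
    one branch and up the other. Both branches have the same length, whence
    the parity; all intermediate vertices lie strictly below level [i], so a
    vertex at level [i] or higher can close the bridge to a cycle. *)
Lemma level_bridge i (a b : G) : l a = i -> l b = i -> connect e a b -> a != b ->
  exists p : seq G, [/\ path e a p, last a p = b, ~~ odd (size p), uniq (a :: p)
    & (1 < size p)%N /\ all (fun v => (v == b) || (l v < i)%N) p].
Proof.
elim: i a b => [|i IHi] a b la lb cab neq_ab.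
  by case/eqP: neq_ab; apply: (level0_inj lG).
have [|a' eaa' la'] := level_parent lG (v := a); first by rewrite la.
have [|b' ebb' lb'] := level_parent lG (v := b); first by rewrite lb.
have eb'b : e b' b by rewrite sedge_sym.
have nab' : a != b' by apply: contra_eq_neq la => ->; rewrite lb' in lb; rewrite -lb; lia.
have na'b : a' != b by apply: contra_eq_neq lb => <-; lia.
have [eab|nab] := eqVneq a' b'.
  exists [:: a'; b]; split=> //=; rewrite ?inE.
  - by rewrite eaa' eab eb'b.
  - by rewrite negb_or eab nab' neq_ab -eab na'b.
  - split=> //=; rewrite eqxx /= andbT; apply/orP; right; lia.
have cab' : connect e a' b'.
  apply: connect_trans (connect1 _) (connect_trans cab (connect1 ebb')).
  by rewrite sedge_sym.
have [||p [pp lp op up [sp /allP ap]]] := IHi a' b' _ _ cab' nab; [lia..|].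
have lt_p v : v \in a' :: p -> (l v < i.+1)%N.
  by rewrite inE => /orP[/eqP->|/ap/orP[/eqP->|]]; lia.
exists (a' :: rcons p b); split.
- by rewrite /= eaa' rcons_path pp lp eb'b.
- by rewrite /= last_rcons.
- by rewrite /= size_rcons /= negbK.
- rewrite -rcons_cons -rcons_cons rcons_uniq inE negb_or eq_sym neq_ab /=.
  have nin v : l v = i.+1 -> v \notin a' :: p by move=> lv; apply/negP => /lt_p; lia.
  by rewrite (nin a la) (nin b lb) -/(uniq (a' :: p)) up.
- split; first by rewrite /= size_rcons.
  apply/allP => v; rewrite -rcons_cons mem_rcons inE => /orP[->//|/lt_p->].
  by rewrite orbT.
Qed.

Hypothesis oddG : odd_cycle_graph G.

Lemma no_two_neighbours_below (a b c : G) :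
  e c a -> e c b -> l a = l b -> (l a <= l c)%N -> a = b.
Proof.
move=> eca ecb lab lac; apply/eqP; apply: contraT => nab.
have cab : connect e a b.
  by apply: connect_trans (connect1 _) (connect1 ecb); rewrite sedge_sym.
have [p [pp lp op up [sp /allP ap]]] := level_bridge erefl (esym lab) cab nab.
have nca v : e c v -> c != v by apply: contraTneq => ->; rewrite sedge_irrefl.
have := oddG (c := [:: c, a & p]); rewrite /= !ltnS (ltnW sp) => /(_ isT).
rewrite negbK (negbTE op) => H; apply: H; apply/andP; split.
  by rewrite /= eca rcons_path pp lp sedge_sym.
rewrite cons_uniq up andbT inE negb_or nca //=.
by apply/negP => /ap/orP[/eqP ecb'|]; [case/eqP: (nca _ ecb)|lia].
Qed.

Lemma lower_neighbour_uniq (v w w' : G) :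
  e v w -> e v w' -> (l w < l v)%N -> (l w' < l v)%N -> w = w'.
Proof.
move=> evw evw' lw lw'; apply: (no_two_neighbours_below evw evw'); last exact: ltnW.
by have := level_step lG evw; have := level_step lG evw'; lia.
Qed.

Lemma same_level_neighbour_uniq (v w w' : G) :
  e v w -> e v w' -> l v = l w -> l v = l w' -> w = w'.
Proof.
move=> evw evw' lw lw'; apply: (no_two_neighbours_below evw evw'); lia.
Qed.

Lemma root_no_same_level_neighbour (w : G) : e u w -> l u != l w.
Proof.
move=> euw; apply/eqP; rewrite (level_root lG) => /esym lw.
have uw := level0_inj lG (level_root lG) lw (connect1 euw).
by rewrite -uw sedge_irrefl in euw.
Qed.
End LevelStructure.

(** * Cones over matchings inside H_n *)

(** List the edges of the matching one after the other, then the unmatched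
    vertices: partners occupy positions [2i] and [2i + 1]. *)
Lemma pairing_order (T : finType) (m : rel T) (S : {set T}) :
  symmetric m -> irreflexive m -> (forall v w w', m v w -> m v w' -> w = w') ->
  (forall v w, v \in S -> m v w -> w \in S) ->
  exists s : seq T, [/\ uniq s, s =i S & forall v w, v \in S -> m v w ->
    (~~ odd (index v s) && (index w s == (index v s).+1)) ||
    (~~ odd (index w s) && (index v s == (index w s).+1))].
Proof.
move=> symm irrm funm; have [k] := ubnP #|S|.
elim: k S => // k IHk S leSk clS.
have [[v w] /andP[/= vS mvw]|nom] := pickP [pred p : T * T | (p.1 \in S) && m p.1 p.2]; last first.
  exists (enum S); split; [exact: enum_uniq|exact: mem_enum|].
  by move=> v w vS mvw; have := nom (v, w); rewrite /= vS mvw.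
have nvw : v != w by apply: contraTneq mvw => ->; rewrite irrm.
have wS := clS _ _ vS mvw.
have [||s [us sS ps]] := IHk (S :\ v :\ w).
- by move: leSk; rewrite (cardsD1 v S) vS (cardsD1 w (S :\ v)) !inE eq_sym nvw wS; lia.
- move=> x y; rewrite !inE => /and3P[nxw nxv xS] mxy.
  rewrite (clS _ _ xS mxy) andbT; apply/andP; split.
    by apply: contraNneq nxv => yw; apply/eqP; apply: (funm w); rewrite symm // -yw.
  by apply: contraNneq nxw => yv; apply/eqP; apply: (funm v); rewrite // symm -yv.
exists [:: v, w & s]; split.
- by rewrite /= !inE !sS !inE !eqxx negb_or nvw us /=.
- move=> x; rewrite !inE sS !inE.
  by have [->|] := eqVneq x v; [rewrite vS|have [->|] := eqVneq x w; [rewrite wS|]].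
move=> x y xS mxy /=.
have [vx|nvx] := eqVneq v x.
  by subst x; rewrite (funm _ _ _ mxy mvw) (negbTE nvw) !eqxx.
have [vy|nvy] := eqVneq v y.
  subst y; rewrite symm in mxy.
  by move: nvx nvw; rewrite (funm _ _ _ mxy mvw) eqxx; case: eqP.
have nwx : w != x.
  by apply: contraNneq nvy => wx; apply/eqP; apply: (funm w); rewrite ?wx // symm -wx.
have nwy : w != y.
  by apply: contraNneq nvx => wy; apply/eqP; apply: (funm w); rewrite symm ?wy // -wy.
rewrite (negbTE nwx) (negbTE nwy) /= !negbK !eqSS; apply: ps => //.
by rewrite !inE eq_sym nwx eq_sym nvx.
Qed.

(** With [u] put in front, the order of [pairing_order] sends the partners to
    [2i + 1] and [2i + 2], which are adjacent in [H_graph]. *)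
Lemma cone_embedding (T : finType) (u : T) (m : rel T) :
  symmetric m -> irreflexive m -> (forall v w w', m v w -> m v w' -> w = w') ->
  (forall w, ~~ m u w) ->
  exists f : T -> 'I_#|T|, [/\ bijective f, (f u = 0 :> nat)%N
    & forall v w, m v w -> H_edge (f v) (f w)].
Proof.
move=> symm irrm funm num.
have nmu v w : m v w -> v != u /\ w != u.
  by move=> mvw; split; apply: contraTneq mvw => ->; rewrite // symm.
have [|s [us sS ps]] := pairing_order (S := [set~ u]) symm irrm funm.
  by move=> v w _ /nmu[_]; rewrite !inE.
pose t := u :: s.
have ut : uniq t by rewrite /= us sS !inE eqxx.
have tT v : v \in t by rewrite inE sS !inE orbN.
have st : size t = #|T| by rewrite -(card_uniqP ut); apply: eq_card => v; rewrite tT.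
have lt v : (index v t < #|T|)%N by rewrite -st index_mem.
pose f v := Ordinal (lt v).
have fI : injective f.
  move=> v w fvw; have h : index v t = index w t := congr1 val fvw.
  by rewrite -(nth_index u (tT v)) h nth_index.
exists f; split.
- by apply: inj_card_bij => //; rewrite card_ord.
- by rewrite /= eqxx.
move=> v w mvw; have [vu wu] := nmu _ _ mvw.
rewrite /H_edge /H_arc /= !(eq_sym u) (negbTE vu) (negbTE wu) /= !eqSS.
by apply: ps => //; rewrite !inE.
Qed.

Local Open Scope ring_scope.

(** * Rayleigh principle for symmetric matrices *)

Section Rayleigh.
Variables (R : realType) (n : nat).
Implicit Types (A B : 'M[R]_n) (x y : 'rV[R]_n).

Definition bform A x y : R := (x *m A *m y^T) 0 0.
Definition norm2 x : R := (x *m x^T) 0 0.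

Lemma norm2E x : norm2 x = \sum_i x 0 i ^+ 2.
Proof. by rewrite /norm2 mxE; apply: eq_bigr => i _; rewrite mxE expr2. Qed.

Lemma norm2_ge0 x : 0 <= norm2 x.
Proof. by rewrite norm2E; apply: sumr_ge0 => i _; apply: sqr_ge0. Qed.

Lemma norm2_eq0 x : (norm2 x == 0) = (x == 0).
Proof.
apply/idP/eqP => [|->]; last by rewrite /norm2 mul0mx mxE.
rewrite norm2E psumr_eq0 => [/allP h|i _]; last exact: sqr_ge0.
by apply/rowP => i; rewrite mxE; apply/eqP; rewrite -sqrf_eq0; apply: h; rewrite mem_index_enum.
Qed.

Lemma norm2_gt0 x : (0 < norm2 x) = (x != 0).
Proof. by rewrite lt_def norm2_ge0 andbT norm2_eq0. Qed.

Lemma bformE A x y : bform A x y = \sum_j (\sum_i x 0 i * A i j) * y 0 j.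
Proof. by rewrite /bform mxE; apply: eq_bigr => j _; rewrite !mxE. Qed.

Lemma bform_scale_sub A a x y : bform (a%:M - A) x y = a * (x *m y^T) 0 0 - bform A x y.
Proof. by rewrite /bform mulmxBr mulmxBl mul_mx_scalar -scalemxAl !mxE. Qed.

(** The entries of [x] are bounded by its norm, so the sum of the [`|A i j|]
    is a bound; adding 1 makes it positive. *)
Lemma bform_bounded A : exists2 C, 0 < C & forall x, bform A x x <= C * norm2 x.
Proof.
exists (1 + \sum_j \sum_i `|A i j|).
  by apply: ltr_wpDr => //; apply: sumr_ge0 => j _; apply: sumr_ge0.
move=> x; rewrite bformE mulrDl mul1r -[leLHS]add0r; apply: lerD (norm2_ge0 x) _.
rewrite mulr_suml; apply: ler_sum => j _; rewrite !mulr_suml; apply: ler_sum => i _.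
have sq k : x 0 k ^+ 2 <= norm2 x.
  rewrite norm2E (bigD1 k) //= lerDl; apply: sumr_ge0 => ? _; exact: sqr_ge0.
have xx : `|x 0 i * x 0 j| <= norm2 x.
  have := sq i; have := sq j; rewrite -(real_normK (num_real (x 0 i))) -(real_normK (num_real (x 0 j))) normrM.
  by have := sqr_ge0 (`|x 0 i| - `|x 0 j|); nra.
rewrite mulrAC mulrC; apply: le_trans (ler_norm _) _; rewrite normrM.
exact: ler_wpM2l.
Qed.

Lemma bform_sym A x y : A^T = A -> bform A x y = bform A y x.
Proof.
move=> sA; rewrite /bform.
by have -> : y *m A *m x^T = (x *m A *m y^T)^T; rewrite ?mxE // !trmx_mul trmxK sA mulmxA.
Qed.

Lemma bformDl A x y z : bform A (x + y) z = bform A x z + bform A y z.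
Proof. by rewrite /bform !mulmxDl mxE. Qed.

Lemma bformZl A a x y : bform A (a *: x) y = a * bform A x y.
Proof. by rewrite /bform -!scalemxAl mxE. Qed.

(** The form at [t *: x + y] is a nonnegative quadratic polynomial in [t]; it is
    enough to look at its vertex, or, when it is affine, at a point where it
    would be negative. *)
Lemma psd_cauchy_schwarz B x y : B^T = B -> (forall z, 0 <= bform B z z) ->
  bform B x y ^+ 2 <= bform B x x * bform B y y.
Proof.
move=> sB pB.
have quad t : 0 <= bform B x x * t ^+ 2 + 2 * bform B x y * t + bform B y y.
  have := pB (t *: x + y).
  suff -> : bform B (t *: x + y) (t *: x + y)
      = bform B x x * t ^+ 2 + 2 * bform B x y * t + bform B y y by [].
  rewrite bformDl bformZl (bform_sym x) // (bform_sym y (_ + _)) // !bformDl !bformZl.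
  by rewrite (bform_sym y x) //; ring.
have [x0|xn0] := eqVneq (bform B x x) 0.
  rewrite x0 mul0r.
  have [->|xy] := eqVneq (bform B x y) 0; first by rewrite expr0n.
  have := quad (- (bform B y y + 1) / (2 * bform B x y)).
  rewrite x0 mul0r add0r mulrCA divff ?mulf_neq0 ?pnatr_eq0 // mulr1. lra.
have xp : 0 < bform B x x by rewrite lt_def xn0 pB.
have := quad (- bform B x y / bform B x x).
set a := bform B x x in xp xn0 *; set b := bform B x y; set c := bform B y y.
move=> h; have : 0 <= a * (a * (- b / a) ^+ 2 + 2 * b * (- b / a) + c).
  by apply: mulr_ge0 => //; apply: ltW.
suff -> : a * (a * (- b / a) ^+ 2 + 2 * b * (- b / a) + c) = a * c - b ^+ 2 by lra.
by field.
Qed.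

Lemma psd_isotropic_ker B x : B^T = B -> (forall z, 0 <= bform B z z) ->
  bform B x x = 0 -> x *m B = 0.
Proof.
move=> sB pB x0; apply/eqP; rewrite -norm2_eq0.
have := psd_cauchy_schwarz x (x *m B) sB pB; rewrite x0 mul0r /bform -/(norm2 (x *m B)).
move=> h; rewrite -sqrf_eq0; apply/eqP/le_anti; rewrite h; exact: sqr_ge0.
Qed.

(** Cauchy-Schwarz for the pair [y *m invmx B], [y] bounds [norm2 y ^+ 2] by
    [bform B y y] times the form of [invmx B] at [y], which is at most a
    multiple of [norm2 y]. *)
Lemma psd_unit_coercive B : B^T = B -> (forall z, 0 <= bform B z z) -> B \in unitmx ->
  exists2 C, 0 < C & forall y, norm2 y <= C * bform B y y.
Proof.
move=> sB pB uB; have [C C0 hC] := bform_bounded (invmx B).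
exists C => // y; have [->|y0] := eqVneq y 0.
  by rewrite /norm2 /bform !mul0mx mxE mulr0.
have Ny : 0 < norm2 y by rewrite norm2_gt0.
have := psd_cauchy_schwarz (y *m invmx B) y sB pB.
have -> : bform B (y *m invmx B) y = norm2 y by rewrite /bform mulmxKV.
have -> : bform B (y *m invmx B) (y *m invmx B) = bform (invmx B) y y.
  by rewrite /bform mulmxKV // trmx_mul trmx_inv sB mulmxA.
move=> h; rewrite -(ler_pM2l Ny) -expr2; apply: le_trans h _.
rewrite mulrCA mulrA; apply: ler_wpM2r => //; by rewrite mulrC.
Qed.

(** The supremum [a] of the Rayleigh quotients bounds every eigenvalue, and
    [a%:M - A] is positive semidefinite. It cannot be invertible: by
    [psd_unit_coercive] a smaller number would still bound all the quotients.
    So [a] is itself an eigenvalue, with no appeal to compactness. *)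
Lemma rayleigh A : (0 < n)%N -> A^T = A ->
  exists a, is_largest_eigenvalue A a /\ forall x, bform A x x <= a * norm2 x.
Proof.
move=> n0 sA.
pose S : set R := [set r | exists2 x, x != 0 & r = bform A x x / norm2 x]%classic.
have [C _ hC] := bform_bounded A.
have ubS : has_ubound S.
  by exists C => _ [x x0 ->]; rewrite ler_pdivrMr ?norm2_gt0.
have S0 : (S !=set0)%classic.
  pose x : 'rV[R]_n := const_mx 1.
  exists (bform A x x / norm2 x), x => //.
  by apply/eqP => /rowP/(_ (Ordinal n0)); rewrite !mxE; apply/eqP; rewrite oner_eq0.
pose a := sup S.
have aP x : bform A x x <= a * norm2 x.
  have [->|x0] := eqVneq x 0; first by rewrite /norm2 /bform !mul0mx mxE mulr0.
  by rewrite -ler_pdivrMr ?norm2_gt0 //; apply: ub_le_sup => //; exists x.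
exists a; split=> //; split; last first.
  move=> b /eigenvalueP[x xA x0].
  rewrite -(ler_pM2r (x := norm2 x)) ?norm2_gt0 //; apply: le_trans (aP x).
  by rewrite /bform xA -scalemxAl mxE.
pose B := a%:M - A.
have sB : B^T = B by rewrite /B linearB /= tr_scalar_mx sA.
have pB z : 0 <= bform B z z by rewrite bform_scale_sub subr_ge0; apply: aP.
have [uB|nuB] := boolP (B \in unitmx).
  have [D D0 hD] := psd_unit_coercive sB pB uB.
  suff : a <= a - D^-1 by rewrite lerDl oppr_ge0 leNgt invr_gt0 D0.
  apply: ge_sup => // _ [x x0 ->]; rewrite ler_pdivrMr ?norm2_gt0 //.
  have := hD x; rewrite bform_scale_sub -/(norm2 x) -(ler_pdivrMl _ _ D0) mulrBl. lra.
move: nuB; rewrite -row_free_unit -kermx_eq0 => /rowV0Pn[x /sub_kermxP xB x0].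
apply/eigenvalueP; exists x => //; move/eqP: xB.
by rewrite mulmxBr subr_eq0 mul_mx_scalar => /eqP.
Qed.

End Rayleigh.

(** * Rayleigh principle for graphs *)

Definition energy (R : realType) (T : finType) (r : rel T) (f : T -> R) : R :=
  \sum_v \sum_(w | r v w) f v * f w.

Definition normsq (R : realType) (T : finType) (f : T -> R) : R := \sum_v f v ^+ 2.

Section GraphRayleigh.
Variables (R : realType) (G : sgraph).
Local Notation rho := (spectral_radius R G).
Let vec (f : G -> R) : 'rV[R]_#|G| := \row_i f (enum_val i).

Let sum_enum (F : G -> R) : \sum_i F (@enum_val G G i) = \sum_v F v.
Proof. by rewrite -(big_enum_val (A := mem G) F). Qed.

Let adj_vec f j : (vec f *m adjacency R G) 0 j = \sum_(w | sedge (enum_val j) w) f w.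
Proof.
rewrite [RHS]big_mkcond -[RHS]sum_enum mxE; apply: eq_bigr => i _; rewrite !mxE sedge_sym.
by case: ifP; rewrite ?mulr1 ?mulr0.
Qed.

Let energy_vec f : energy (@sedge G) f = bform (adjacency R G) (vec f) (vec f).
Proof.
rewrite /energy /bform mxE -[LHS]sum_enum; apply: eq_bigr => j _.
by rewrite adj_vec !mxE mulrC mulr_sumr.
Qed.

Let normsq_vec f : normsq f = norm2 (vec f).
Proof. by rewrite /normsq norm2E -[LHS]sum_enum; apply: eq_bigr => i _; rewrite mxE. Qed.

Let adjacency_sym : (adjacency R G)^T = adjacency R G.
Proof. by apply/matrixP => i j; rewrite !mxE sedge_sym. Qed.

Lemma spectral_radiusP : (0 < #|G|)%N ->
  (forall f : G -> R, energy (@sedge G) f <= rho * normsq f) /\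
  exists f : G -> R, (exists v, f v != 0) /\ energy (@sedge G) f = rho * normsq f.
Proof.
move=> G0; have [a [la aP]] := rayleigh G0 adjacency_sym.
have -> : rho = a.
  apply: xget_unique => // b lb; apply: le_anti.
  by rewrite (la.2 b lb.1) (lb.2 a la.1).
split=> [f|]; first by rewrite energy_vec normsq_vec.
have /eigenvalueP[x xA x0] := la.1.
have vx : vec (fun v => x 0 (enum_rank v)) = x.
  by apply/rowP => i; rewrite mxE enum_valK.
exists (fun v => x 0 (enum_rank v)); split.
  apply/existsP; apply: contraNT x0 => /existsPn h; apply/eqP/rowP => i.
  by rewrite mxE; have := h (enum_val i); rewrite enum_valK negbK => /eqP.
by rewrite energy_vec normsq_vec vx /bform xA -scalemxAl mxE.
Qed.

(** A maximizer of the Rayleigh quotient is isotropic for the positive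
    semidefinite form of [rho%:M - A], hence in its kernel. *)
Lemma maximizer_eigen (f : G -> R) v : (0 < #|G|)%N ->
  energy (@sedge G) f = rho * normsq f -> \sum_(w | sedge v w) f w = rho * f v.
Proof.
move=> G0 fE; have [rP _] := spectral_radiusP G0.
pose B := rho%:M - adjacency R G.
have sB : B^T = B by rewrite /B linearB /= tr_scalar_mx adjacency_sym.
have vx (x : 'rV[R]_#|G|) : vec (fun v => x 0 (enum_rank v)) = x.
  by apply/rowP => i; rewrite mxE enum_valK.
have pB (x : 'rV[R]_#|G|) : 0 <= bform B x x.
  by rewrite bform_scale_sub -/(norm2 x) subr_ge0 -(vx x) -energy_vec -normsq_vec.
have : vec f *m B = 0.
  apply: psd_isotropic_ker => //.
  by rewrite bform_scale_sub -/(norm2 (vec f)) -energy_vec fE normsq_vec subrr.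
rewrite mulmxBr mul_mx_scalar => /eqP; rewrite subr_eq0 => /eqP/rowP/(_ (enum_rank v)).
by rewrite adj_vec !mxE enum_rankK => ->.
Qed.

(** Absolute values preserve the norm of a maximizer and do not decrease its
    energy. *)
Lemma exists_perron_vector : (0 < #|G|)%N -> exists f : G -> R,
  [/\ forall v, 0 <= f v, exists v, 0 < f v & energy (@sedge G) f = rho * normsq f].
Proof.
move=> G0; have [rP [f [[v fv] fE]]] := spectral_radiusP G0.
exists (fun v => `|f v|); split => //; first by exists v; rewrite normr_gt0.
have nE : normsq (fun v => `|f v|) = normsq f.
  by apply: eq_bigr => w _; rewrite real_normK ?num_real.
apply: le_anti; rewrite rP nE -fE; apply: ler_sum => x _; apply: ler_sum => y _.
by rewrite -normrM ler_norm.
Qed.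

Lemma spectral_radius_empty : #|G| = 0%N -> rho = 0.
Proof.
move=> G0; apply: xgetPN => a [/eigenvalueP[x _ /eqP[]]].
by apply/rowP => i; have := ltn_ord i; rewrite [X in (_ < X)%N]G0.
Qed.

End GraphRayleigh.

(** * Comparison of energies *)

Section Energy.
Variables (R : realType) (T : finType).
Implicit Types (r p m : rel T) (f : T -> R) (u v w : T).

Lemma eq_energy r r' f : r =2 r' -> energy r f = energy r' f.
Proof. by move=> rr'; apply: eq_bigr => v _; apply: eq_bigl => w. Qed.

Lemma energy_ge0 r f : (forall v, 0 <= f v) -> 0 <= energy r f.
Proof. by move=> f0; do 2!apply: sumr_ge0 => ? _; apply: mulr_ge0. Qed.

Lemma energy_flip r f : energy r f = energy (fun v w => r w v) f.
Proof.
rewrite /energy (exchange_big_dep predT) //=; apply: eq_bigr => v _.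
by apply: eq_bigr => w _; rewrite mulrC.
Qed.

Lemma energy_split r p f :
  energy r f = energy (fun v w => r v w && p v w) f
             + energy (fun v w => r v w && ~~ p v w) f.
Proof. by rewrite /energy -big_split; apply: eq_bigr => v _; rewrite (bigID (p v)). Qed.

Lemma energy_subrel r r' f : subrel r r' ->
  energy r' f = energy r f + energy (fun v w => r' v w && ~~ r v w) f.
Proof.
move=> rr'; rewrite (energy_split r' r); congr (_ + _); apply: eq_energy => v w.
by apply: andb_idl; apply: rr'.
Qed.

Lemma le_energy r r' f : (forall v, 0 <= f v) -> subrel r r' -> energy r f <= energy r' f.
Proof. by move=> f0 /energy_subrel->; rewrite lerDl energy_ge0. Qed.

(** A pair related by [r'] but not by [r] would contribute a positive term. *)
Lemma energy_inj r r' f : (forall v, 0 < f v) -> subrel r r' ->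
  energy r f = energy r' f -> r =2 r'.
Proof.
move=> f0 rr' /eqP; rewrite (energy_subrel f rr') -subr_eq0 opprD addrA subrr sub0r oppr_eq0.
rewrite psumr_eq0 => [/allP h v w|v _]; last first.
  by apply: sumr_ge0 => w _; apply/ltW/mulr_gt0.
apply/idP/idP => [/rr'//|r'vw]; apply: contraT => nr.
have := h v (mem_index_enum v); rewrite /= psumr_eq0 => [/allP/(_ w (mem_index_enum w))|? _].
  by rewrite r'vw nr /= mulf_eq0 !gt_eqF.
by apply/ltW/mulr_gt0.
Qed.

Definition down r (l : T -> nat) : rel T := fun v w => r v w && (l w < l v)%N.
Definition flat r (l : T -> nat) : rel T := fun v w => r v w && (l v == l w).

(** Pairs going up and pairs going down contribute equally. *)
Lemma energy_levels r l f : symmetric r ->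
  energy r f = 2 * energy (down r l) f + energy (flat r l) f.
Proof.
move=> symr; rewrite (energy_split r (fun v w => l v == l w)) addrC; congr (_ + _).
rewrite (energy_split _ (fun v w => l w < l v)%N) mulrC mulr_natr mulr2n; congr (_ + _).
  by apply: eq_energy => v w; rewrite /down; case: ltngtP; rewrite ?andbT ?andbF.
rewrite energy_flip; apply: eq_energy => v w; rewrite /down symr.
by case: ltngtP; rewrite ?andbT ?andbF.
Qed.

(** The exclusive or joins [u] to all the other vertices, but not to itself. *)
Definition cone u m : rel T := fun v w => (v == u) (+) (w == u) || m v w.

Section Cone.
Variables (u : T) (m : rel T).
Hypotheses (symm : symmetric m) (num : forall w, ~~ m u w).
Let height v : nat := (v != u).

Lemma cone_sym : symmetric (cone u m).
Proof. by move=> v w; rewrite /cone addbC symm. Qed.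

Lemma down_cone_sum f v :
  \sum_(w | down (cone u m) height v w) f v * f w = if v == u then 0 else f v * f u.
Proof.
have [->|vu] := eqVneq v u.
  by rewrite big_pred0 // => w; rewrite /down /height eqxx /= ltn0 andbF.
rewrite (big_pred1 u) // => w; rewrite /down /height /cone (negbTE vu) /=.
by case: (w == u); case: (m v w).
Qed.

Lemma flat_cone : flat (cone u m) height =2 m.
Proof.
move=> v w; rewrite /flat /height /cone.
have [->|vu] := eqVneq v u; have [->|wu] := eqVneq w u => //=.
- by rewrite andbT.
- by rewrite (negbTE (num _)).
- by rewrite symm (negbTE (num _)).
- by rewrite andbT.
Qed.

End Cone.
End Energy.

Section Comparison.
Variables (R : realType) (G : sgraph) (u : G) (l : G -> nat) (f : G -> R).
Hypotheses (oddG : odd_cycle_graph G) (lG : leveling u l).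
Hypotheses (f0 : forall v, 0 <= f v) (fu : forall v, f v <= f u).
Local Notation e := (@sedge G).
Local Notation m := (flat e l).

Lemma flat_sym : symmetric m.
Proof. by move=> v w; rewrite /flat sedge_sym eq_sym. Qed.

Lemma flat_root w : ~~ m u w.
Proof.
apply/negP => /andP[euw]; apply/negP; exact: (root_no_same_level_neighbour lG).
Qed.

Lemma flat_irrefl : irreflexive m.
Proof. by move=> v; rewrite /flat sedge_irrefl. Qed.

Lemma flat_functional v w w' : m v w -> m v w' -> w = w'.
Proof.
move=> /andP[evw /eqP lw] /andP[evw' /eqP lw'].
exact: (same_level_neighbour_uniq lG oddG evw evw').
Qed.

Let height v : nat := (v != u).
Let low v := \sum_(w | down e l v w) f v * f w.

Let low_eq v w : down e l v w -> low v = f v * f w.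
Proof.
move=> dvw; rewrite /low (big_pred1 w) // => w' /=; apply/idP/eqP => [|->] //.
move: dvw => /andP[evw lw] /andP[evw' lw'].
exact: (lower_neighbour_uniq lG oddG evw').
Qed.

Let low_le v : low v <= \sum_(w | down (cone u m) height v w) f v * f w.
Proof.
rewrite down_cone_sum; have [w dvw|no] := pickP (down e l v); last first.
  by rewrite /low big_pred0 //; case: ifP => // _; apply: mulr_ge0.
rewrite (low_eq dvw) ifF; first exact: ler_wpM2l.
by apply: contraTF dvw => /eqP->; rewrite /down (level_root lG) andbF.
Qed.

(** The levels of the cone are 0 for the apex and 1 for the rest, so both sides
    split as in [energy_levels] with the same horizontal part, the matching;
    the downward parts are compared vertex by vertex. *)
Lemma energy_le_cone : energy e f <= energy (cone u m) f.
Proof.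
rewrite (energy_levels l) ?(energy_levels height f (cone_sym u flat_sym)); last exact: sedge_sym.
rewrite (eq_energy f (flat_cone flat_sym flat_root)) lerD2r ler_pM2l //.
by apply: ler_sum => v _; apply: low_le.
Qed.

Lemma energy_eq_cone_parent : (forall v, 0 < f v) ->
  energy e f = energy (cone u m) f ->
  forall v, v != u -> exists2 w, down e l v w & f w = f u.
Proof.
move=> fp; rewrite (energy_levels l f (@sedge_sym G)) (energy_levels height f (cone_sym u flat_sym)).
rewrite (eq_energy f (flat_cone flat_sym flat_root)) => /addIr /mulfI eqlow.
have {}eqlow : energy (down e l) f = energy (down (cone u m) height) f.
  by apply: eqlow; rewrite pnatr_eq0.
have := leif_sum (fun v (_ : predT v) => leif_eq (low_le v)).
move=> [_]; rewrite [X in X = _](introT eqP eqlow) => /esym/forallP h v vu.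
have := h v; rewrite /= down_cone_sum (negbTE vu) => /eqP lowE.
have [w dvw|no] := pickP (down e l v).
  by exists w => //; move: lowE; rewrite (low_eq dvw) => /mulfI; apply; rewrite gt_eqF.
move: lowE; rewrite /low big_pred0 // => /esym/eqP.
by rewrite mulf_eq0 !gt_eqF.
Qed.

End Comparison.

(** * Transport along bijections *)

Section PullBack.
Variables (R : realType) (T : finType) (H : sgraph) (phi : T -> H).
Hypotheses (bij_phi : bijective phi) (H0 : (0 < #|H|)%N).
Let r : rel T := fun v w => sedge (phi v) (phi w).
Local Notation rho := (spectral_radius R H).

Let energy_pull (h : H -> R) : energy r (h \o phi) = energy (@sedge H) h.
Proof.
rewrite /energy [RHS](reindex phi) /=; last exact: onW_bij.
by apply: eq_bigr => v _; rewrite [RHS](reindex phi) //; exact: onW_bij.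
Qed.

Let normsq_pull (h : H -> R) : normsq (h \o phi) = normsq h.
Proof. by rewrite /normsq [RHS](reindex phi) //; exact: onW_bij. Qed.

Let pull_surj (f : T -> R) : exists h : H -> R, f = h \o phi.
Proof.
have [psi phiK psiK] := bij_phi.
by exists (f \o psi); apply/funext => v /=; rewrite phiK.
Qed.

(** The relation [r] makes [phi] an isomorphism from [T] onto [H]; working with
    it keeps all functions and sums over the vertices of one graph. *)
Lemma pull_rayleigh (f : T -> R) : energy r f <= rho * normsq f.
Proof.
have [h ->] := pull_surj f.
by rewrite energy_pull normsq_pull; apply: (spectral_radiusP R H0).1.
Qed.

Lemma pull_eigen (f : T -> R) v : energy r f = rho * normsq f ->
  \sum_(w | r v w) f w = rho * f v.
Proof.
have [h ->] := pull_surj f; rewrite energy_pull normsq_pull => fE.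
rewrite -(maximizer_eigen (phi v) H0 fE).
by rewrite [RHS](reindex phi) //; exact: onW_bij.
Qed.

End PullBack.

Lemma normsq_gt0 (R : realType) (T : finType) (f : T -> R) v : f v != 0 -> 0 < normsq f.
Proof.
move=> fv; rewrite /normsq (bigD1 v) //= ltr_wpDr //.
  by apply: sumr_ge0 => x _; apply: sqr_ge0.
by rewrite lt_def sqrf_eq0 fv sqr_ge0.
Qed.

Lemma le_spectral_radius_iso (R : realType) (G H : sgraph) : sgraph_iso G H ->
  spectral_radius R G <= spectral_radius R H.
Proof.
move=> [phi [bij_phi ephi]]; have cGH := bij_eq_card bij_phi.
have [G0|G0] := posnP #|G|.
  by rewrite !spectral_radius_empty // -cGH.
have H0 : (0 < #|H|)%N by rewrite -cGH.
have [_ [f [[v fv] fE]]] := spectral_radiusP R G0.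
rewrite -(ler_pM2r (normsq_gt0 fv)) -fE -(eq_energy f ephi); exact: pull_rayleigh.
Qed.

Lemma sgraph_iso_sym (G H : sgraph) : sgraph_iso G H -> sgraph_iso H G.
Proof.
move=> [f [[g fK gK] ef]]; exists g; split; first by exists f.
by move=> x y; rewrite -ef !gK.
Qed.

(** * Positive eigenvectors of a cone *)

(** A zero at a neighbour of [u] would force, by the eigenvalue equation, all
    values around it to vanish, among them that at [u]. *)
Lemma dominated_eigen_gt0 (R : realType) (T : finType) (r : rel T) (u : T) (f : T -> R) (a : R) :
  (forall v, v != u -> r v u) -> (forall v, \sum_(w | r v w) f w = a * f v) ->
  (forall v, 0 <= f v) -> 0 < f u -> forall v, 0 < f v.
Proof.
move=> ru fa f0 fu v; have [->//|vu] := eqVneq v u.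
rewrite lt_def f0 andbT; apply: contraTneq fu => fv.
rewrite -leNgt; have := fa v; rewrite fv mulr0 (bigD1 u) /= => [<-|]; last exact: ru.
by rewrite lerDl; apply: sumr_ge0.
Qed.

Section ConeEigen.
Variables (R : realType) (T : finType) (u : T) (m : rel T) (f : T -> R) (a : R).
Hypothesis (irrm : irreflexive m).
Hypothesis (fa : forall v, \sum_(w | cone u m v w) f w = a * f v).

(** Equal values at [w] and at [u] mean equal sums over their neighbours. After
    removing the terms [f u] and [f w], equal as well, the sum at [u] runs over
    all remaining vertices, that at [w] only over the partners of [w]. *)
Lemma cone_eigen_center w v : (forall v, 0 < f v) -> f w = f u -> w != u ->
  v != u -> v != w -> m w v.
Proof.
move=> f0 fw wu vu vw; apply: contraT => nm.
have := fa w; rewrite fw -fa (bigD1 u) /=; last by rewrite /cone eqxx (negbTE wu).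
rewrite [RHS](bigD1 w) /=; last by rewrite /cone eqxx (negbTE wu).
rewrite fw => /addrI eq_sum.
suff : \sum_(x | cone u m w x && (x != u)) f x < \sum_(x | cone u m u x && (x != w)) f x.
  by rewrite eq_sum ltxx.
rewrite [ltRHS](bigD1 v) /=; last by rewrite vw /cone eqxx (negbTE vu).
apply: ltr_pwDl => //; rewrite big_mkcond [leRHS]big_mkcond; apply: ler_sum => x _.
case: ifP => [/andP[wx xu]|_]; last by case: ifP => // _; apply: ltW.
have {wx} mwx : m w x by move: wx; rewrite /cone (negbTE wu) (negbTE xu).
rewrite ifT // /cone eqxx (negbTE xu) /=; apply/andP; split.
  by apply: contraTneq mwx => ->; rewrite irrm.
by apply: contraNneq nm => <-.
Qed.

End ConeEigen.

(** * The extremal graph *)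

Section Extremal.
Variables (R : realType) (G : sgraph).
Hypotheses (oddG : odd_cycle_graph G) (G0 : (0 < #|G|)%N).
Local Notation H := (H_graph #|G|).

Lemma H_edge_matching_cone (u : G) (m : rel G) (phi : G -> 'I_#|G|) :
  bijective phi -> (phi u = 0 :> nat)%N ->
  (forall v w, m v w -> H_edge (phi v) (phi w)) ->
  subrel (cone u m) (fun v w => H_edge (phi v) (phi w)).
Proof.
move=> /bij_inj injphi phiu mH.
have phi0 v : v != u -> (0 < phi v)%N.
  by rewrite lt0n; apply: contra_neq => v0; apply/injphi/val_inj; rewrite /= v0 phiu.
move=> v w; rewrite /cone => /orP[|/mH//].
have [->|vu] := eqVneq v u; have [->|wu] := eqVneq w u => //= _.
  by rewrite /H_edge /H_arc phiu phi0.
by rewrite /H_edge /H_arc phiu phi0 // orbC.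
Qed.

Lemma odd_cycle_spectral_radius_le : spectral_radius R G <= spectral_radius R H /\
  (spectral_radius R G = spectral_radius R H -> sgraph_iso G H).
Proof.
have H0 : (0 < #|H|)%N by rewrite card_ord.
have [f [f0 [v0 fv0] fE]] := exists_perron_vector R G0.
pose u := [arg max_(v > v0) f v]%O.
have fu v : f v <= f u by rewrite /u; case: arg_maxP => // w _; apply.
have fu0 : 0 < f u := lt_le_trans fv0 (fu v0).
have [l lG] := exists_leveling u.
pose m := flat (@sedge G) l.
have symm : symmetric m := @flat_sym G l.
have irrm : irreflexive m := @flat_irrefl G l.
have [phi [bij_phi phiu mH]] := cone_embedding symm irrm (flat_functional oddG lG) (flat_root lG).
have coneH := H_edge_matching_cone bij_phi phiu mH.
have le1 := energy_le_cone oddG lG f0 fu.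
have le2 := le_energy f0 coneH.
have le3 := pull_rayleigh (R := R) (H := H) bij_phi H0 f.
have Nf := normsq_gt0 (lt0r_neq0 fu0).
split; first by rewrite -(ler_pM2r Nf) -fE; apply: le_trans le1 (le_trans le2 le3).
move=> rhoE; rewrite -rhoE -fE in le3.
pose r : rel G := fun v w => H_edge (phi v) (phi w).
have eq12 : energy (@sedge G) f = energy (cone u m) f.
  by apply: le_anti; rewrite le1 (le_trans le2 le3).
have eq23 : energy (cone u m) f = energy r f.
  by apply: le_anti; rewrite le2 -eq12 le3.
have fr v : \sum_(w | r v w) f w = spectral_radius R H * f v.
  apply: (pull_eigen (H := H) bij_phi H0 v).
  change (energy r f = spectral_radius R H * normsq f).
  by rewrite -rhoE -fE eq12 eq23.
(* Only the inclusion [coneH] is available here: equality of the cone with [r]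
   needs positivity first. *)
have fp : forall v, 0 < f v.
  apply: (dominated_eigen_gt0 _ fr f0 fu0) => v vu.
  by apply: coneH; rewrite /cone eqxx (negbTE vu).
have cone_r := energy_inj fp coneH eq23.
have fcone v : \sum_(w | cone u m v w) f w = spectral_radius R H * f v.
  by rewrite -fr; apply: eq_bigl; exact: cone_r.
(* The lower neighbour of [v] given by the equality case is [w] by uniqueness;
   if it is not [u], then [v] is its partner, in the same level. *)
have down_u v w : down (@sedge G) l v w -> w = u.
  move=> dvw; have vu : v != u.
    by apply: contraTneq dvw => ->; rewrite /down (level_root lG) andbF.
  have [w' dvw' fw'] := energy_eq_cone_parent oddG lG f0 fu fp eq12 vu.
  move: dvw dvw' => /andP[evw lw] /andP[evw' lw'].
  have eww' := lower_neighbour_uniq lG oddG evw evw' lw lw'; subst w'.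
  apply/eqP; apply: contraT => wu.
  have vw : v != w by apply: contraTneq lw => ->; rewrite ltnn.
  have /andP[_ /eqP lwv] := cone_eigen_center irrm fcone fp fw' wu vu vw.
  by rewrite lwv ltnn in lw.
have e_u v : v != u -> sedge v u.
  move=> vu; have [w dvw _] := energy_eq_cone_parent oddG lG f0 fu fp eq12 vu.
  by rewrite -(down_u _ _ dvw); case/andP: dvw.
have e_cone v w : sedge v w = cone u m v w.
  apply/idP/idP => [evw|/orP[|/andP[]//]]; last first.
    have [->|vu] := eqVneq v u; have [->|wu] := eqVneq w u => //= _.
      by rewrite sedge_sym e_u.
    exact: e_u.
  rewrite /cone /m /flat evw /=; have [lvw|lwv|_] := ltngtP (l v) (l w); rewrite ?orbT ?orbF //.
    have -> : v = u by apply: (down_u w); rewrite /down sedge_sym evw.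
    rewrite eqxx; have [wu|//] := eqVneq w u.
    by rewrite wu (level_root lG) in lvw.
  have -> : w = u by apply: (down_u v); rewrite /down evw.
  rewrite eqxx; have [vu|//] := eqVneq v u.
  by rewrite vu (level_root lG) in lwv.
exists phi; split => // v w; rewrite e_cone; exact/esym/cone_r.
Qed.

End Extremal.

Theorem corollary2p9 (R : realType) (n : nat) (G : sgraph)
    (hn : #|G| = n) (hG : odd_cycle_graph G) :
  spectral_radius R G <= spectral_radius R (H_graph n) /\
  (spectral_radius R G = spectral_radius R (H_graph n) <->
   sgraph_iso G (H_graph n)).
Proof.
subst n; have iso_eq : sgraph_iso G (H_graph #|G|) ->
    spectral_radius R G = spectral_radius R (H_graph #|G|).
  move=> GH; apply: le_anti; rewrite le_spectral_radius_iso //=.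
  exact/le_spectral_radius_iso/sgraph_iso_sym.
have [G0|G0] := posnP #|G|; last first.
  by have [le_rho eq_iso] := odd_cycle_spectral_radius_le R hG G0; split.
have GH : sgraph_iso G (H_graph #|G|).
  have no (v : G) : False by have := card0_eq G0 v; rewrite inE.
  have f (v : G) : 'I_#|G| by case: (no v).
  exists f; split; last by move=> x; case: (no x).
  by apply: inj_card_bij; [move=> x; case: (no x)|rewrite card_ord].
by rewrite iso_eq.
Qed.
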